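(* A category is a left Rees category if and only if it is isomorphic to a Zappa–Szép product $C\bowtie G$ of a free category $C$ by a groupoid $G$ (with respect to some self-similar action of $G$ on $C$).
   Context: Categories are small and viewed as sets of arrows with objects replaced by identities; each arrow $a$ has domain $\mathbf{d}(a)$ and codomain $\mathbf{r}(a)$, and $ab$ is defined iff $\mathbf{r}(a)=\mathbf{d}(b)$. The free category on a directed graph has the vertices as identities and consists of all finite directed paths under concatenation. $C$ is right rigid if $aC\cap bC\neq\emptyset$ implies $aC\subseteq bC$ or $bC\subseteq aC$. A left Rees category is a left cancellative ($ax=ay\Rightarrow x=y$), right rigid category in which each principal right ideal $aC$ is properly contained in only finitely many distinct principal right ideals. Self-similar action: let $G$ be a groupoid and $C$ a category with the same set of identities $G_o=C_o$. Let $G*C=\{(g,x): \mathbf{r}(g)=\mathbf{d}(x)\}$. A self-similar action of $G$ on $C$ is a pair of functions $G*C\to C$, $(g,x)\mapsto g\cdot x$, and $G*C\to G$, $(g,x)\mapsto g|_x$, such that (C1) $\mathbf{d}(g\cdot x)=\mathbf{d}(g)$; (C2) $\mathbf{r}(g\cdot x)=\mathbf{d}(g|_x)$; (C3) $\mathbf{r}(x)=\mathbf{r}(g|_x)$; (SS1) $\mathbf{d}(x)\cdot x=x$; (SS2) $(gh)\cdot x=g\cdot(h\cdot x)$ if $gh$ is defined and $\mathbf{r}(h)=\mathbf{d}(x)$; (SS3) $g\cdot\mathbf{r}(g)=\mathbf{d}(g)$; (SS4) $\mathbf{d}(x)|_x=\mathbf{r}(x)$; (SS5) $g|_{\mathbf{r}(g)}=g$;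 (SS6) $g|_{xy}=(g|_x)|_y$ if $xy$ is defined and $\mathbf{r}(g)=\mathbf{d}(x)$; (SS7) $(gh)|_x=g|_{h\cdot x}\,h|_x$ if $gh$ is defined and $\mathbf{r}(h)=\mathbf{d}(x)$; (SS8) $g\cdot(xy)=(g\cdot x)(g|_x\cdot y)$ if $xy$ is defined and $\mathbf{r}(g)=\mathbf{d}(x)$. The Zappa–Szép product is $C\bowtie G=\{(x,g)\in C\times G:\mathbf{r}(x)=\mathbf{d}(g)\}$ with $\mathbf{d}(x,g)=(\mathbf{d}(x),\mathbf{d}(x))$, $\mathbf{r}(x,g)=(\mathbf{r}(g),\mathbf{r}(g))$ and, when $\mathbf{r}(g)=\mathbf{d}(y)$, $(x,g)(y,h)=(x(g\cdot y),\,g|_y h)$. *)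

(* Defs.v *)
From mathcomp Require Import all_boot.
From mathcomp Require Import boolp classical_sets cardinality.

Set Implicit Arguments.
Unset Strict Implicit.
Unset Printing Implicit Defensive.

Local Open Scope classical_set_scope.

(* Composition is written in diagrammatic order.  It takes a proof of
   composability as an argument; laws are stated for arbitrary such proofs, so
   that the choice of proof is immaterial.  Objects are kept as a separate type
   O, which stands for the set of identities, so that two categories with the
   same set of identities are two categories over the same O. *)
Record category (O : Type) := Category {
  arrow :> Type;
  dom : arrow -> O;
  cod : arrow -> O;
  idt : O -> arrow;
  comp : forall a b : arrow, cod a = dom b -> arrow;
  dom_idt : forall u, dom (idt u) = u;
  cod_idt : forall u, cod (idt u) = u;
  dom_comp : forall a b (ab : cod a = dom b), dom (comp ab) = dom a;
  cod_comp : forall a b (ab : cod a = dom b), cod (comp ab) = cod b;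
  comp_idl : forall u a (ua : cod (idt u) = dom a), comp ua = a;
  comp_idr : forall a u (au : cod a = dom (idt u)), comp au = a;
  comp_assoc : forall a b c (ab : cod a = dom b) (ab_c : cod (comp ab) = dom c)
    (bc : cod b = dom c) (a_bc : cod a = dom (comp bc)), comp ab_c = comp a_bc
}.
Arguments dom {O C} : rename.
Arguments cod {O C} : rename.
Arguments idt {O C} : rename.
Arguments comp {O C} a b : rename.

Record groupoid (O : Type) := Groupoid {
  groupoid_category :> category O;
  has_inverse : forall g : groupoid_category,
    exists (h : groupoid_category) (gh : cod g = dom h) (hg : cod h = dom g),
      comp g h gh = idt (dom g) /\ comp h g hg = idt (cod g)
}.

Record functor (O O' : Type) (C : category O) (D : category O') := Functor {
  fobj : O -> O';
  farr :> C -> D;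
  farr_dom : forall a, dom (farr a) = fobj (dom a);
  farr_cod : forall a, cod (farr a) = fobj (cod a);
  farr_idt : forall u, farr (idt u) = idt (fobj u);
  farr_comp : forall a b (ab : cod a = dom b) (Fab : cod (farr a) = dom (farr b)),
    farr (comp a b ab) = comp (farr a) (farr b) Fab
}.

Definition isomorphic (O O' : Type) (C : category O) (D : category O') : Prop :=
  exists F : functor C D, bijective (fobj F) /\ bijective (farr F).

Section LeftRees.
Variables (O : Type) (C : category O).

Definition principal_right_ideal (a : C) : set C :=
  [set b | exists (x : C) (ax : cod a = dom x), b = comp a x ax].

Definition left_cancellative : Prop :=
  forall (a x y : C) (ax : cod a = dom x) (ay : cod a = dom y),
    comp a x ax = comp a y ay -> x = y.

Definition right_rigid : Prop :=
  forall a b : C,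
    principal_right_ideal a `&` principal_right_ideal b !=set0 ->
    principal_right_ideal a `<=` principal_right_ideal b \/
    principal_right_ideal b `<=` principal_right_ideal a.

Definition left_Rees : Prop :=
  [/\ left_cancellative,
      right_rigid
    & forall a : C, finite_set [set I : set C |
        (exists b : C, I = principal_right_ideal b) /\
        principal_right_ideal a `<` I]].

End LeftRees.

Section Free.
Variable V : Type.

Record digraph := Digraph {
  edge : Type;
  source : edge -> V;
  target : edge -> V
}.

Variable Q : digraph.

Fixpoint is_path (v : V) (s : seq (edge Q)) : Prop :=
  if s is e :: s' then source e = v /\ is_path (target e) s' else True.

Definition path_end (v : V) (s : seq (edge Q)) : V := last v (map (@target Q) s).

(* The starting vertex is recorded in order to have one empty path per vertex. *)
Definition dipath : Type := {p : V * seq (edge Q) | is_path p.1 p.2}.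

Definition dipath_dom (p : dipath) : V := (sval p).1.
Definition dipath_cod (p : dipath) : V := path_end (sval p).1 (sval p).2.
Definition dipath_idt (v : V) : dipath := exist _ (v, [::]) I.

Lemma is_path_cat v s t :
  is_path v s -> is_path (path_end v s) t -> is_path v (s ++ t).
Proof.
rewrite /path_end; elim: s v => [|e s IHs] v //= [ev es] et.
by split=> //; apply: IHs.
Qed.

Lemma dipath_comp_subproof (p q : dipath) : dipath_cod p = dipath_dom q ->
  is_path (sval p).1 ((sval p).2 ++ (sval q).2).
Proof.
move=> pq; apply: is_path_cat (svalP p) _.
by rewrite [path_end _ _]pq; exact: (svalP q).
Qed.

Definition dipath_comp (p q : dipath) (pq : dipath_cod p = dipath_dom q) : dipath :=
  exist _ ((sval p).1, (sval p).2 ++ (sval q).2) (dipath_comp_subproof pq).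

Lemma dipath_eq (p q : dipath) : sval p = sval q -> p = q.
Proof.
case: p q => [p Hp] [q Hq] /= pq; subst q.
by congr exist; apply: Prop_irrelevance.
Qed.

Definition free_category : category V.
Proof.
refine (@Category V dipath dipath_dom dipath_cod dipath_idt dipath_comp
          _ _ _ _ _ _ _) => //.
- by move=> p q; rewrite /dipath_cod /dipath_dom /path_end /= map_cat last_cat => ->.
- move=> u [[v s] Hs] uv; apply: dipath_eq => /=.
  by rewrite [u]uv.
- by move=> [[v s] Hs] u vu; apply: dipath_eq; rewrite /= cats0.
- by move=> p q t pq pqt qt pqt'; apply: dipath_eq; rewrite /= catA.
Defined.

End Free.

Record self_similar_action (O : Type) (G : groupoid O) (C : category O) :=
  SelfSimilarAction {
  act : forall (g : G) (x : C), cod g = dom x -> C;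
  rst : forall (g : G) (x : C), cod g = dom x -> G;
  ssa_C1 : forall g x (gx : cod g = dom x), dom (act gx) = dom g;
  ssa_C2 : forall g x (gx : cod g = dom x), cod (act gx) = dom (rst gx);
  ssa_C3 : forall g x (gx : cod g = dom x), cod x = cod (rst gx);
  ssa_SS1 : forall (x : C) (ix : cod (idt (dom x) : G) = dom x), act ix = x;
  ssa_SS2 : forall (g h : G) (x : C) (gh : cod g = dom h) (hx : cod h = dom x)
      (gh_x : cod (comp g h gh) = dom x) (g_hx : cod g = dom (act hx)),
    act gh_x = act g_hx;
  ssa_SS3 : forall (g : G) (gi : cod g = dom (idt (cod g) : C)),
    act gi = idt (dom g);
  ssa_SS4 : forall (x : C) (ix : cod (idt (dom x) : G) = dom x),
    rst ix = idt (cod x);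
  ssa_SS5 : forall (g : G) (gi : cod g = dom (idt (cod g) : C)), rst gi = g;
  ssa_SS6 : forall (g : G) (x y : C) (gx : cod g = dom x) (xy : cod x = dom y)
      (g_xy : cod g = dom (comp x y xy)) (gx_y : cod (rst gx) = dom y),
    rst g_xy = rst gx_y;
  ssa_SS7 : forall (g h : G) (x : C) (gh : cod g = dom h) (hx : cod h = dom x)
      (gh_x : cod (comp g h gh) = dom x) (g_hx : cod g = dom (act hx))
      (rr : cod (rst g_hx) = dom (rst hx)),
    rst gh_x = comp (rst g_hx) (rst hx) rr;
  ssa_SS8 : forall (g : G) (x y : C) (gx : cod g = dom x) (xy : cod x = dom y)
      (g_xy : cod g = dom (comp x y xy)) (gx_y : cod (rst gx) = dom y)
      (aa : cod (act gx) = dom (act gx_y)),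
    act g_xy = comp (act gx) (act gx_y) aa
}.
Arguments act {O G C} A g x : rename.
Arguments rst {O G C} A g x : rename.

Section ZappaSzep.
Variables (O : Type) (G : groupoid O) (C : category O).
Variable A : self_similar_action G C.

Lemma comp_congr (D : category O) (a a' b b' : D) (ab : cod a = dom b)
    (ab' : cod a' = dom b') :
  a = a' -> b = b' -> comp a b ab = comp a' b' ab'.
Proof. by move=> ea eb; subst a' b'; congr comp; apply: Prop_irrelevance. Qed.

Lemma act_congr (g g' : G) (x x' : C) (gx : cod g = dom x) (gx' : cod g' = dom x') :
  g = g' -> x = x' -> act A g x gx = act A g' x' gx'.
Proof. by move=> eg ex; subst g' x'; congr act; apply: Prop_irrelevance. Qed.

Lemma rst_congr (g g' : G) (x x' : C) (gx : cod g = dom x) (gx' : cod g' = dom x') :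
  g = g' -> x = x' -> rst A g x gx = rst A g' x' gx'.
Proof. by move=> eg ex; subst g' x'; congr rst; apply: Prop_irrelevance. Qed.

Definition zs_arrow : Type := {p : C * G | cod p.1 = dom p.2}.

Definition zs_dom (p : zs_arrow) : O := dom (sval p).1.
Definition zs_cod (p : zs_arrow) : O := cod (sval p).2.

Lemma zs_idt_subproof (u : O) : cod (idt u : C) = dom (idt u : G).
Proof. by rewrite cod_idt dom_idt. Qed.

Definition zs_idt (u : O) : zs_arrow :=
  exist _ (idt u, idt u) (zs_idt_subproof u).

Section Comp.
Variables (p q : zs_arrow) (pq : zs_cod p = zs_dom q).
Let x := (sval p).1.
Let g := (sval p).2.
Let y := (sval q).1.
Let h := (sval q).2.

Lemma zs_comp_fst : cod x = dom (act A g y pq).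
Proof. by rewrite ssa_C1; apply: svalP p. Qed.

Lemma zs_comp_snd : cod (rst A g y pq) = dom h.
Proof. by rewrite -ssa_C3; apply: svalP q. Qed.

Lemma zs_comp_subproof :
  cod (comp x (act A g y pq) zs_comp_fst) = dom (comp (rst A g y pq) h zs_comp_snd).
Proof. by rewrite cod_comp dom_comp ssa_C2. Qed.

Definition zs_comp : zs_arrow :=
  exist _ (comp x (act A g y pq) zs_comp_fst, comp (rst A g y pq) h zs_comp_snd)
        zs_comp_subproof.

End Comp.

Lemma zs_eq (p q : zs_arrow) :
  (sval p).1 = (sval q).1 -> (sval p).2 = (sval q).2 -> p = q.
Proof.
case: p q => [[x g] Hp] [[y h] Hq] /= exy egh; subst y h.
by congr exist; apply: Prop_irrelevance.
Qed.

Lemma zs_comp_idl u p (up : zs_cod (zs_idt u) = zs_dom p) : zs_comp up = p.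
Proof.
have eu : u = dom (sval p).1 by move: up; rewrite /zs_cod /= cod_idt.
subst u; apply: zs_eq => /=; first by rewrite comp_idl ssa_SS1.
case: p up => [[x g] /= xg] up.
have ig : cod (idt (cod x) : G) = dom g by rewrite cod_idt.
rewrite -[RHS](comp_idl ig); apply: comp_congr => //.
exact: ssa_SS4.
Qed.

Lemma zs_comp_idr p u (pu : zs_cod p = zs_dom (zs_idt u)) : zs_comp pu = p.
Proof.
have eu : cod (sval p).2 = u by move: pu; rewrite /zs_dom /= dom_idt.
subst u; apply: zs_eq => /=; last by rewrite comp_idr ssa_SS5.
case: p pu => [[x g] /= xg] pu.
have xi : cod x = dom (idt (dom g) : C) by rewrite dom_idt.
rewrite -[RHS](comp_idr xi); apply: comp_congr => //.
exact: ssa_SS3.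
Qed.

Lemma zs_comp_assoc p q r (pq : zs_cod p = zs_dom q) (pq_r : zs_cod (zs_comp pq) = zs_dom r)
    (qr : zs_cod q = zs_dom r) (p_qr : zs_cod p = zs_dom (zs_comp qr)) :
  zs_comp pq_r = zs_comp p_qr.
Proof.
case: p q r pq pq_r qr p_qr => [[x g] /= xg] [[y h] /= yh] [[z k] /= zk].
move=> pq pq_r qr p_qr.
have gy : cod g = dom y := pq.
have hz : cod h = dom z := qr.
have g'h : cod (rst A g y pq) = dom h by rewrite -ssa_C3.
have g'hz : cod (rst A g y pq) = dom (act A h z qr) by rewrite ssa_C1.
have y_hz : cod y = dom (act A h z qr) by rewrite ssa_C1.
have g_yhz : cod g = dom (comp y (act A h z qr) y_hz) by rewrite dom_comp.
have g'h_z : cod (comp (rst A g y pq) h g'h) = dom z by rewrite cod_comp.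
have x_gy : cod x = dom (act A g y pq) by rewrite ssa_C1.
have gy_g'hz : cod (act A g y pq) = dom (act A _ _ g'hz) by rewrite ssa_C1 ssa_C2.
have xgy_ : cod (comp _ _ x_gy) = dom (act A _ _ g'hz) by rewrite cod_comp.
have x_ : cod x = dom (comp _ _ gy_g'hz) by rewrite dom_comp.
have rr : cod (rst A _ _ g'hz) = dom (rst A _ _ qr) by rewrite -ssa_C3 ssa_C2.
have rk : cod (rst A _ _ qr) = dom k by rewrite -ssa_C3.
have rr_k : cod (comp _ _ rr) = dom k by rewrite cod_comp.
have r_rk : cod (rst A _ _ g'hz) = dom (comp _ _ rk) by rewrite dom_comp.
apply: zs_eq => /=.
- transitivity (comp _ _ xgy_).
    apply: comp_congr; first exact: comp_congr.
    transitivity (act A _ _ g'h_z); first by apply: act_congr => //; exact: comp_congr.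
    exact: ssa_SS2.
  rewrite (comp_assoc _ x_); apply: comp_congr => //.
  transitivity (act A _ _ g_yhz); first exact: (esym (ssa_SS8 g_yhz gy_g'hz)).
  by apply: act_congr => //; exact: comp_congr.
- transitivity (comp _ _ rr_k).
    apply: comp_congr => //.
    transitivity (rst A _ _ g'h_z); first by apply: rst_congr => //; exact: comp_congr.
    exact: ssa_SS7.
  rewrite (comp_assoc _ r_rk); apply: comp_congr; last exact: comp_congr.
  transitivity (rst A _ _ g_yhz); first exact: (esym (ssa_SS6 g_yhz g'hz)).
  by apply: rst_congr => //; exact: comp_congr.
Qed.

Definition zappa_szep : category O.
Proof.
refine (@Category O zs_arrow zs_dom zs_cod zs_idt zs_comp
          _ _ _ _ zs_comp_idl zs_comp_idr zs_comp_assoc).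
- by move=> u; apply: dom_idt.
- by move=> u; apply: cod_idt.
- by move=> p q pq; apply: dom_comp.
- by move=> p q pq; apply: cod_comp.
Defined.

End ZappaSzep.

(* Main.v *)
(* In a left Rees category S an arrow a is an "atom" when aS is maximal among
   the proper principal right ideals of its domain.  The ideals above aS form a
   finite chain, and climbing it writes a as a product of atoms and an
   invertible arrow.  Once a representative is fixed in each ideal generated by
   an atom, this factorization is unique: rigidity forces the first atoms of two
   factorizations to agree, and left cancellation removes them.  So S = C G with
   C free on the representatives and G the groupoid of invertible arrows, and
   refactoring g x with g in G and x in C as (g . x) g|_x gives the self-similar
   action.

   Conversely, the first projection from the Zappa-Szep product to C preserves
   and reflects inclusion of principal right ideals, because G acts invertibly;
   so the order conditions descend from those of the free category, where
   inclusion of ideals is the prefix order. *)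
From mathcomp Require Import all_boot finmap.
From mathcomp Require Import boolp classical_sets cardinality.
Require Import Defs.

Set Implicit Arguments.
Unset Strict Implicit.
Unset Printing Implicit Defensive.

Local Open Scope classical_set_scope.

(** * Divisibility and invertible arrows in a category, with total composition *)

Section TotalComposition.
Variables (O : Type) (C : category O).
Implicit Types a b c x y : C.

(* Composition as a total operation; the junk value on non-composable arrows
   is chosen to make [dom_mul] unconditional. *)
Definition mul a b : C :=
  if pselect (cod a = dom b) is left ab then comp a b ab else a.

Lemma compE a b (ab : cod a = dom b) : comp a b ab = mul a b.
Proof.
by rewrite /mul; case: pselect => // ab'; congr comp; apply: Prop_irrelevance.
Qed.

Lemma dom_mul a b : dom (mul a b) = dom a.
Proof. by rewrite /mul; case: pselect => // ab; rewrite dom_comp. Qed.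

Lemma cod_mul a b : cod a = dom b -> cod (mul a b) = cod b.
Proof. by move=> ab; rewrite -(compE ab) cod_comp. Qed.

Lemma mul_idl u a : u = dom a -> mul (idt u) a = a.
Proof.
move=> ua; have ia : cod (idt u : C) = dom a by rewrite cod_idt.
by rewrite -(compE ia) comp_idl.
Qed.

Lemma mul_idr a u : cod a = u -> mul a (idt u) = a.
Proof.
move=> au; have ai : cod a = dom (idt u : C) by rewrite dom_idt.
by rewrite -(compE ai) comp_idr.
Qed.

Lemma mulA a b c : cod a = dom b -> cod b = dom c ->
  mul (mul a b) c = mul a (mul b c).
Proof.
move=> ab bc.
have ab_c : cod (comp a b ab) = dom c by rewrite cod_comp.
have a_bc : cod a = dom (comp b c bc) by rewrite dom_comp.
by have := comp_assoc ab_c a_bc; rewrite !compE.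
Qed.

Lemma principal_right_idealE a b :
  principal_right_ideal a b <-> exists2 x, cod a = dom x & b = mul a x.
Proof.
split=> [[x [ax ->]]|[x ax ->]]; first by exists x; rewrite ?compE.
by exists x, ax; rewrite compE.
Qed.

Lemma principal_right_ideal_refl a : principal_right_ideal a a.
Proof.
by apply/principal_right_idealE; exists (idt (cod a));
  rewrite ?dom_idt ?mul_idr.
Qed.

Lemma principal_right_ideal_trans b a c : principal_right_ideal a b ->
  principal_right_ideal b c -> principal_right_ideal a c.
Proof.
move=> /principal_right_idealE[x ax ->] /principal_right_idealE[y].
rewrite cod_mul// => xy ->; apply/principal_right_idealE.
by exists (mul x y); rewrite ?dom_mul ?mulA.
Qed.

(** Turns inclusion of ideals into divisibility of generators, the form in which rigidity and
    finiteness are exploited below. *)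
Lemma principal_right_ideal_sub a b :
  principal_right_ideal a `<=` principal_right_ideal b <->
  principal_right_ideal b a.
Proof.
split=> [|ba c]; first by apply; exact: principal_right_ideal_refl.
exact: principal_right_ideal_trans.
Qed.

Lemma principal_right_ideal_dom a b :
  principal_right_ideal a b -> dom b = dom a.
Proof. by move=> /principal_right_idealE[x _ ->]; rewrite dom_mul. Qed.

Lemma principal_right_ideal_idt a : principal_right_ideal (idt (dom a)) a.
Proof.
by apply/principal_right_idealE; exists a; rewrite ?cod_idt ?mul_idl.
Qed.

Definition is_inverse a b : Prop :=
  [/\ cod a = dom b, cod b = dom a,
      mul a b = idt (dom a) & mul b a = idt (cod a)].

Definition invertible a : Prop := exists b, is_inverse a b.

Lemma is_inverse_sym a b : is_inverse a b -> is_inverse b a.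
Proof. by case=> ab ba eab eba; split; rewrite // ?eab ?eba -?ab ?ba. Qed.

Lemma unit_idt u : invertible (idt u : C).
Proof.
by exists (idt u); split; rewrite ?cod_idt ?dom_idt// mul_idl ?dom_idt.
Qed.

Lemma unit_mul a b : cod a = dom b -> invertible a -> invertible b ->
  invertible (mul a b).
Proof.
move=> ab [a' [aa' a'a eaa' ea'a]] [b' [bb' b'b ebb' eb'b]].
exists (mul b' a').
have b'a' : cod b' = dom a' by rewrite b'b -ab aa'.
split; rewrite ?dom_mul ?cod_mul//.
- rewrite mulA ?dom_mul// -[mul b _]mulA// ebb' mul_idl -?aa'//.
- rewrite mulA ?dom_mul// -[mul a' _]mulA// ea'a mul_idl//.
Qed.

Definition unit_arrow : Type := {a : C | invertible a}.

Lemma unit_comp_subproof (g h : unit_arrow) (gh : cod (sval g) = dom (sval h)) :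
  invertible (comp (sval g) (sval h) gh).
Proof. by rewrite compE; apply: unit_mul => //; apply: svalP. Qed.

Lemma unit_arrow_eq (g h : unit_arrow) : sval g = sval h -> g = h.
Proof.
case: g h => [g ug] [h uh] /= gh; subst h.
by congr exist; apply: Prop_irrelevance.
Qed.

Definition unit_category : category O.
Proof.
refine (@Category O unit_arrow (fun g => dom (sval g)) (fun g => cod (sval g))
  (fun u => exist _ (idt u) (unit_idt u))
  (fun g h gh => exist _ (comp (sval g) (sval h) gh) (unit_comp_subproof gh))
  _ _ _ _ _ _ _) => /=.
- by move=> u; rewrite dom_idt.
- by move=> u; rewrite cod_idt.
- by move=> g h gh; rewrite dom_comp.
- by move=> g h gh; rewrite cod_comp.
- by move=> u g ug; apply: unit_arrow_eq; rewrite /= comp_idl.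
- by move=> g u gu; apply: unit_arrow_eq; rewrite /= comp_idr.
- by move=> g h k gh gh_k hk g_hk; apply: unit_arrow_eq; apply: comp_assoc.
Defined.

Definition unit_groupoid : groupoid O.
Proof.
apply: (@Groupoid O unit_category) => -[g ug].
have [h gh] := ug; have uh : invertible h by exists g; apply: is_inverse_sym.
case: gh => gh hg egh ehg; exists (exist _ h uh), gh, hg.
by split; apply: unit_arrow_eq; rewrite /= compE.
Defined.

End TotalComposition.

(** * From unique factorization as path times unit to a Zappa-Szép product *)

Section Factorization.
Variables (O : Type) (S : category O) (Q : digraph O) (lab : edge Q -> S).
Hypotheses (dom_lab : forall e, dom (lab e) = source e)
           (cod_lab : forall e, cod (lab e) = target e).

(** On paths, this is the functor that extends [lab] by the universal property of the free
    category. *)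
Fixpoint path_value (v : O) (s : seq (edge Q)) : S :=
  if s is e :: s' then mul (lab e) (path_value (target e) s') else idt v.

Definition dipath_value (p : free_category Q) : S :=
  path_value (sval p).1 (sval p).2.

Lemma dom_path_value v s : is_path v s -> dom (path_value v s) = v.
Proof. by case: s => [|e s] /=; rewrite ?dom_idt// dom_mul dom_lab => -[]. Qed.

Lemma cod_path_value v s : is_path v s -> cod (path_value v s) = path_end v s.
Proof.
rewrite /path_end; elim: s v => [|e s IHs] v /=; first by rewrite cod_idt.
by case=> _ es; rewrite cod_mul ?IHs// cod_lab dom_path_value.
Qed.

Lemma path_value_cat v s t : is_path v s -> is_path (path_end v s) t ->
  path_value v (s ++ t) = mul (path_value v s) (path_value (path_end v s) t).
Proof.
rewrite /path_end; elim: s v => [|e s IHs] v /=.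
  by move=> _ vt; rewrite mul_idl ?dom_path_value.
case=> _ es et; rewrite IHs// mulA ?cod_lab ?dom_path_value//.
by rewrite cod_path_value.
Qed.

Lemma dom_dipath_value p : dom (dipath_value p) = dom p.
Proof. exact: dom_path_value (svalP p). Qed.

Lemma cod_dipath_value p : cod (dipath_value p) = cod p.
Proof. exact: cod_path_value (svalP p). Qed.

Lemma dipath_value_comp (p q : free_category Q) (pq : cod p = dom q) :
  dipath_value (comp p q pq) = mul (dipath_value p) (dipath_value q).
Proof.
rewrite /dipath_value /= path_value_cat; first by rewrite [path_end _ _]pq.
  exact: (svalP p).
by rewrite [path_end _ _]pq; apply: (svalP q).
Qed.

Local Notation G := (unit_groupoid S).

Hypothesis factorization_ex : forall a : S,
  exists (p : free_category Q) (u : G),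
    cod p = dom u /\ a = mul (dipath_value p) (sval u).
Hypothesis factorization_uniq : forall (p q : free_category Q) (u v : G),
  cod p = dom u -> cod q = dom v ->
  mul (dipath_value p) (sval u) = mul (dipath_value q) (sval v) ->
  p = q /\ u = v.

Definition path_part (a : S) : free_category Q := sval (cid (factorization_ex a)).
Definition unit_part (a : S) : G := sval (cid (svalP (cid (factorization_ex a)))).

Lemma cod_path_part a : cod (path_part a) = dom (unit_part a).
Proof. by have [] := svalP (cid (svalP (cid (factorization_ex a)))). Qed.

Lemma factorizationE a : mul (dipath_value (path_part a)) (sval (unit_part a)) = a.
Proof. by have [] := svalP (cid (svalP (cid (factorization_ex a)))). Qed.

Lemma dom_path_part a : dom (path_part a) = dom a.
Proof. by rewrite -dom_dipath_value -[in RHS](factorizationE a) dom_mul. Qed.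

Lemma cod_unit_part a : cod (unit_part a) = cod a.
Proof.
by rewrite -[in RHS](factorizationE a) cod_mul// cod_dipath_value cod_path_part.
Qed.

Lemma path_part_mul a (p : free_category Q) (u : G) : cod p = dom u ->
  a = mul (dipath_value p) (sval u) -> path_part a = p.
Proof.
move=> pu aE; have /(factorization_uniq (cod_path_part a) pu)[] // :=
  etrans (factorizationE a) aE.
Qed.

Lemma unit_part_mul a (p : free_category Q) (u : G) : cod p = dom u ->
  a = mul (dipath_value p) (sval u) -> unit_part a = u.
Proof.
move=> pu aE; have /(factorization_uniq (cod_path_part a) pu)[] // :=
  etrans (factorizationE a) aE.
Qed.

Lemma factorization_act_mul (g h : G) (x : free_category Q) : cod g = dom h ->
  cod h = dom x ->
  let hx := mul (sval h) (dipath_value x) in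
  let ghx := mul (sval g) (dipath_value (path_part hx)) in
  mul (sval g) hx =
  mul (dipath_value (path_part ghx)) (mul (sval (unit_part ghx)) (sval (unit_part hx))).
Proof.
move=> gh hxd hx ghx.
have dhx : dom hx = dom h by rewrite dom_mul.
have ghxd : cod (sval g) = dom (dipath_value (path_part hx)).
  by rewrite dom_dipath_value dom_path_part dhx.
have cvhx : cod (dipath_value (path_part hx)) = dom (sval (unit_part hx)).
  by rewrite cod_dipath_value cod_path_part.
rewrite -mulA.
- by rewrite factorizationE /ghx mulA// factorizationE.
- by rewrite cod_dipath_value cod_path_part.
- by rewrite [LHS]cod_unit_part /ghx cod_mul.
Qed.

(** Moves [g] past [x] and then the resulting unit past [y]. By uniqueness, the path and the unit
    obtained give (SS8) and (SS6). *)
Lemma factorization_mul_act (g : G) (x y : free_category Q) (gx : cod g = dom x)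
    (xy : cod x = dom y) :
  let gvx := mul (sval g) (dipath_value x) in
  let ry := mul (sval (unit_part gvx)) (dipath_value y) in
  mul (sval g) (dipath_value (comp x y xy)) =
  mul (mul (dipath_value (path_part gvx)) (dipath_value (path_part ry)))
      (sval (unit_part ry)).
Proof.
move=> gvx ry.
have gvxd : cod (sval g) = dom (dipath_value x) by rewrite dom_dipath_value.
have vxy : cod (dipath_value x) = dom (dipath_value y).
  by rewrite cod_dipath_value dom_dipath_value.
have cpu : cod (dipath_value (path_part gvx)) = dom (sval (unit_part gvx)).
  by rewrite cod_dipath_value cod_path_part.
have uy : cod (sval (unit_part gvx)) = dom (dipath_value y).
  by rewrite [LHS]cod_unit_part cod_mul.
rewrite dipath_value_comp -mulA// -/gvx -[in LHS](factorizationE gvx).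
rewrite !mulA ?factorizationE//.
- by rewrite cpu dom_dipath_value dom_path_part dom_mul.
- by rewrite cod_dipath_value cod_path_part.
Qed.

(** Each equational axiom is proved by exhibiting one factorization of the product in question and
    comparing parts by uniqueness. *)
Definition factorization_action : self_similar_action G (free_category Q).
Proof.
refine (@SelfSimilarAction O G (free_category Q)
  (fun g x _ => path_part (mul (sval g) (dipath_value x)))
  (fun g x _ => unit_part (mul (sval g) (dipath_value x)))
  _ _ _ _ _ _ _ _ _ _ _).
- by move=> g x gx; rewrite dom_path_part dom_mul.
- by move=> g x gx; rewrite cod_path_part.
- move=> g x gx; rewrite cod_unit_part cod_mul ?cod_dipath_value//.
  by rewrite dom_dipath_value.
- move=> x ix; apply: (@path_part_mul _ x (idt (cod x))); rewrite ?dom_idt//.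
  by rewrite /= mul_idl ?mul_idr// ?cod_dipath_value ?dom_dipath_value.
- move=> g h x gh hx gh_x g_hx.
  set hvx := mul (sval h) (dipath_value x).
  have hvxd : cod h = dom (dipath_value x) by rewrite dom_dipath_value.
  have rr : cod (unit_part (mul (sval g) (dipath_value (path_part hvx)))) =
      dom (unit_part hvx).
    rewrite cod_unit_part cod_mul ?cod_dipath_value ?cod_path_part//.
    by rewrite dom_dipath_value.
  apply: (@path_part_mul _ _ (comp _ _ rr)); first by rewrite dom_comp cod_path_part.
  rewrite /= !compE mulA ?dom_dipath_value//.
  exact: factorization_act_mul.
- move=> g gi; apply: (@path_part_mul _ (idt (dom g)) g).
    by rewrite cod_idt.
  by rewrite /= /dipath_value /= mul_idl ?mul_idr.
- move=> x ix; apply: (@unit_part_mul _ x (idt (cod x))); rewrite ?dom_idt//.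
  by rewrite /= mul_idl ?mul_idr// ?cod_dipath_value ?dom_dipath_value.
- move=> g gi; apply: (@unit_part_mul _ (idt (dom g)) g).
    by rewrite cod_idt.
  by rewrite /= /dipath_value /= mul_idl ?mul_idr.
- move=> g x y gx xy g_xy gx_y.
  have aa : cod (path_part (mul (sval g) (dipath_value x))) =
      dom (path_part (mul (sval (unit_part (mul (sval g) (dipath_value x))))
                       (dipath_value y))).
    by rewrite cod_path_part dom_path_part dom_mul.
  apply: (@unit_part_mul _ (comp _ _ aa)).
    by rewrite cod_comp cod_path_part.
  by rewrite (factorization_mul_act gx) dipath_value_comp.
- move=> g h x gh hx gh_x g_hx rr.
  apply: (@unit_part_mul _ (path_part (mul (sval g) (dipath_value
    (path_part (mul (sval h) (dipath_value x))))))).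
    by rewrite dom_comp cod_path_part.
  rewrite /= !compE mulA ?dom_dipath_value//.
  exact: factorization_act_mul.
- move=> g x y gx xy g_xy gx_y aa.
  apply: (@path_part_mul _ _ (unit_part (mul
    (sval (unit_part (mul (sval g) (dipath_value x)))) (dipath_value y)))).
    by rewrite cod_comp cod_path_part.
  by rewrite (factorization_mul_act gx) dipath_value_comp.
Defined.

Lemma factorization_isomorphic : isomorphic S (zappa_szep factorization_action).
Proof.
pose F (a : S) : zappa_szep factorization_action :=
  exist _ (path_part a, unit_part a) (cod_path_part a).
unshelve eexists (@Functor _ _ S (zappa_szep factorization_action) id F _ _ _ _).
- by move=> a; rewrite -dom_path_part.
- by move=> a; rewrite -cod_unit_part.
- move=> u; apply: zs_eq => /=.
    apply: (@path_part_mul _ (idt u) (idt u)); rewrite ?dom_idt//.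
    by rewrite /= mul_idl ?dom_idt.
  apply: (@unit_part_mul _ (idt u) (idt u)); rewrite ?dom_idt//.
  by rewrite /= mul_idl ?dom_idt.
- move=> a b ab Fab.
  have uvp : cod (sval (unit_part a)) = dom (dipath_value (path_part b)).
    by rewrite dom_dipath_value dom_path_part [LHS]cod_unit_part.
  have pu c : cod (dipath_value (path_part c)) = dom (sval (unit_part c)).
    by rewrite cod_dipath_value cod_path_part.
  pose w := mul (sval (unit_part a)) (dipath_value (path_part b)).
  have cw : cod w = dom (sval (unit_part b)) by rewrite cod_mul ?pu.
  have E : mul a b =
      mul (mul (dipath_value (path_part a)) (dipath_value (path_part w)))
          (mul (sval (unit_part w)) (sval (unit_part b))).
    transitivity (mul (dipath_value (path_part a)) (mul w (sval (unit_part b)))).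
      rewrite -[in LHS](factorizationE a) -[in LHS](factorizationE b).
      by rewrite mulA ?dom_mul// -[mul (sval (unit_part a)) _]mulA.
    have uw : cod (sval (unit_part w)) = dom (sval (unit_part b)).
      by rewrite [LHS]cod_unit_part.
    have paw : cod (dipath_value (path_part a)) = dom (dipath_value (path_part w)).
      by rewrite pu dom_dipath_value dom_path_part dom_mul.
    by rewrite -[in LHS](factorizationE w) [in LHS]mulA ?pu// (mulA paw) ?dom_mul.
  have H := @zs_comp_subproof _ _ _ factorization_action (F a) (F b) Fab.
  apply: zs_eq => /=.
  + apply: (path_part_mul H).
    by rewrite dipath_value_comp /= !compE.
  + apply: (unit_part_mul H).
    by rewrite dipath_value_comp /= !compE.
split; first by exists id.
exists (fun z => mul (dipath_value (sval z).1) (sval (sval z).2)) => [a|[[p u] pu]].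
  exact: factorizationE.
by apply: (@zs_eq _ G (free_category Q) (F _) (exist _ (p, u) pu)) => /=;
  [exact: (path_part_mul pu)|exact: (unit_part_mul pu)].
Qed.

End Factorization.

(** * Unique factorization into atoms and a unit in a left Rees category *)

Section LeftReesFactorization.
Variables (O : Type) (S : category O).
Hypothesis S_left_Rees : left_Rees S.
Implicit Types a b c d x y : S.

Local Notation ideal := (@principal_right_ideal O S).

Lemma mulI a x y : cod a = dom x -> cod a = dom y -> mul a x = mul a y -> x = y.
Proof.
by case: S_left_Rees => lc _ _ ax ay; rewrite -(compE ax) -(compE ay); apply: lc.
Qed.

(** A right inverse [b] is two-sided: [a b a = a], and cancelling [a] on the left leaves [b a] equal
    to an identity. *)
Lemma unit_ideal a : ideal a (idt (dom a)) -> invertible a.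
Proof.
move=> /principal_right_idealE[b ab abE].
have cb : cod b = dom a by rewrite -(cod_mul ab) -abE cod_idt.
exists b; split=> //; apply: (@mulI a); rewrite ?dom_mul ?dom_idt//.
by rewrite -mulA// -abE mul_idl// mul_idr.
Qed.

Lemma ideal_eq a b : ideal a b -> ideal b a -> ideal a = ideal b.
Proof.
by move=> ab ba; apply/seteqP; split; apply/principal_right_ideal_sub.
Qed.

(** Writing [a = b u] and [b = a v] gives [b = b u v], so [u v] is an identity by cancellation and
    [u] is invertible. *)
Lemma ideal_eq_unit a b : ideal a = ideal b ->
  exists2 u, cod b = dom u & invertible u /\ a = mul b u.
Proof.
move=> E; have /principal_right_idealE[u bu aE] : ideal b a.
  by rewrite -E; exact: principal_right_ideal_refl.
have /principal_right_idealE[v av bE] : ideal a b.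
  by rewrite E; exact: principal_right_ideal_refl.
exists u => //; split=> //; apply: unit_ideal; apply/principal_right_idealE.
have uv : cod u = dom v by rewrite -av aE cod_mul.
exists v => //; apply: (@mulI b); rewrite ?dom_mul ?dom_idt//.
by rewrite mul_idr// -mulA// -aE.
Qed.

Lemma ideal_mul_unit a u : cod a = dom u -> invertible u -> ideal (mul a u) = ideal a.
Proof.
move=> au [v [uv vu uvE vuE]]; apply: ideal_eq; apply/principal_right_idealE.
  by exists v; rewrite ?cod_mul// mulA// uvE mul_idr.
by exists u.
Qed.

Lemma ideal_rigid a b c : ideal a c -> ideal b c -> ideal b a \/ ideal a b.
Proof.
move=> ac bc; case: S_left_Rees => _ rr _.
have [|/principal_right_ideal_sub|/principal_right_ideal_sub] := rr a b.
- by exists c.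
- by left.
- by right.
Qed.

Definition above a : set (set S) :=
  [set I | (exists b, I = ideal b) /\ ideal a `<` I].

(** The measure for climbing the ideals above [a]. The value of [fset_set] on infinite sets is a
    default, excluded here by the left Rees finiteness condition. *)
Definition height a : nat := #|` fset_set (above a)|.

(** Every ideal strictly above that of [b] is strictly above that of [a], and the ideal of [b]
    itself belongs to the second family only. *)
Lemma height_lt a b : ideal b a -> ~ ideal a b -> (height b < height a)%N.
Proof.
have fin c : finite_set (above c) by case: S_left_Rees => _ _; apply.
move=> ba nab; apply: fproper_ltn_card; rewrite fproperE.
have ab : ideal a `<` ideal b.
  by split; [apply/principal_right_ideal_sub|move=> /principal_right_ideal_sub].
apply/andP; split.
  apply/fsubsetP => I; rewrite !in_fset_set// !inE => -[Ib [bI nIb]].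
  split=> //; split; first by case: ab => ab _; apply: subset_trans bI.
  by move=> Ia; apply: nIb; apply: subset_trans Ia _; case: ab.
apply/negP => /fsubsetP /(_ (ideal b)); rewrite !in_fset_set// !inE.
by case; [split=> //; exists b | move=> _ []].
Qed.

Definition atom a : Prop :=
  ~ invertible a /\ forall b, ideal b a -> invertible b \/ ideal a b.

(** Rigidity makes the two ideals comparable. Since neither atom is invertible, maximality turns the
    inclusion into an equality. *)
Lemma atom_ideal_eq a b c : atom a -> atom b -> ideal a c -> ideal b c ->
  ideal a = ideal b.
Proof.
move=> [nua aa] [nub ab] ac bc.
by case: (ideal_rigid ac bc) => [/[dup] ba /aa[]//|/[dup] ba /ab[]//] ?;
  apply: ideal_eq.
Qed.

(** Edges are ideals and not atoms: atoms with the same ideal differ by a unit, so distinct edges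
    for them would destroy unique factorization. *)
Definition atom_ideal : Type := {I : set S | exists a, atom a /\ I = ideal a}.

Definition atom_rep (I : atom_ideal) : S := sval (cid (svalP I)).

Lemma atom_repP I : atom (atom_rep I) /\ sval I = ideal (atom_rep I).
Proof. exact: (svalP (cid (svalP I))). Qed.

Lemma atom_rep_inj I J : ideal (atom_rep I) = ideal (atom_rep J) -> I = J.
Proof.
have [_ EI] := atom_repP I; have [_ EJ] := atom_repP J; rewrite -EI -EJ.
case: I J {EI EJ} => [I HI] [J HJ] /= IJ; subst J.
by congr exist; apply: Prop_irrelevance.
Qed.

Lemma atom_rep_ex a : atom a -> exists I, ideal (atom_rep I) = ideal a.
Proof.
move=> aa; have HI : exists b, atom b /\ ideal a = ideal b by exists a.
pose J : atom_ideal := exist _ (ideal a) HI.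
by exists J; have [_ /esym] := atom_repP J.
Qed.

Definition atom_digraph : digraph O :=
  {| edge := atom_ideal;
     source := fun I => dom (atom_rep I);
     target := fun I => cod (atom_rep I) |}.

Local Notation Q := atom_digraph.
Local Notation value := (@dipath_value O S Q atom_rep).
Local Notation G := (unit_groupoid S).

Lemma cod_value p : cod (value p) = cod p.
Proof. exact: cod_dipath_value. Qed.

Definition edge_path (e : edge Q) : free_category Q :=
  exist (fun p : O * seq (edge Q) => is_path p.1 p.2) (source e, [:: e]) (conj erefl I).

Lemma edge_path_value e : value (edge_path e) = atom_rep e.
Proof. exact: mul_idr. Qed.

(* An ideal [yS] strictly between [cS] and the trivial one would put
   [mul b y] strictly between [mul b c] and [b], against maximality. *)
Lemma cover_atom b c : cod b = dom c -> ~ ideal (mul b c) b ->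
  (forall y, ideal y (mul b c) -> ~ ideal (mul b c) y -> (height y <= height b)%N) ->
  atom c.
Proof.
move=> bc nab max; split.
  by move=> uc; apply: nab; rewrite ideal_mul_unit//; exact: principal_right_ideal_refl.
move=> y yc; case: (pselect (invertible y)); first by left.
move=> nuy; case: (pselect (ideal c y)) => [|ncy]; first by right.
have by_ : cod b = dom y by rewrite -(principal_right_ideal_dom yc).
have bby : ideal b (mul b y) by apply/principal_right_idealE; exists y.
have nbyb : ~ ideal (mul b y) b.
  move=> /principal_right_idealE[z]; rewrite cod_mul// => yz bE.
  apply: nuy; apply: unit_ideal; apply/principal_right_idealE; exists z => //.
  by apply: (@mulI b); rewrite ?dom_mul ?dom_idt// mul_idr// -mulA.
(* [mul b y] is higher than [b], which [max] forbids once its ideal is shown to lie strictly above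
   that of [mul b c]. *)
have := height_lt bby nbyb; rewrite ltnNge max//.
  move: yc => /principal_right_idealE[z yz cE]; apply/principal_right_idealE.
  by exists z; rewrite ?cod_mul// mulA// cE.
move=> /principal_right_idealE[z]; rewrite cod_mul// => cz yE.
apply: ncy; apply/principal_right_idealE; exists z => //.
by apply: (@mulI b); rewrite ?dom_mul// -mulA.
Qed.

(** Induction on height: a non-invertible [a] is factored through an arrow [b] just above it, and
    the remaining factor contributes the last atom. *)
Lemma value_factorization_ex a : exists (p : free_category Q) (u : G),
  cod p = dom u /\ a = mul (value p) (sval u).
Proof.
have [n] := ubnP (height a); elim: n a => // n IHn a; rewrite ltnS => an.
case: (pselect (invertible a)) => [ua|nua].
  exists (idt (dom a)), (exist _ a ua); split; first exact: cod_idt.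
  exact: esym (mul_idl (erefl (dom a))).
(* Choosing [b] of greatest height strictly above [a] leaves no ideal in between. The identity is a
   candidate because [a] is not invertible. *)
pose P k := `[< exists b, [/\ ideal b a, ~ ideal a b & height b = k] >].
have exP : exists k, P k.
  exists (height (idt (dom a))); apply/asboolP; exists (idt (dom a)); split=> //.
    exact: principal_right_ideal_idt.
  by move=> /unit_ideal.
have ubP k : P k -> (k <= height a)%N.
  by move=> /asboolP[b [ba nab <-]]; apply/ltnW/height_lt.
have [k /asboolP[b [ba nab bk]] kmax] := ex_maxnP exP ubP.
have [|p [u [pu bE]]] := IHn b; first exact: leq_trans (height_lt ba nab) an.
have /principal_right_idealE[c bc aE] := ba.
have puv : cod (value p) = dom (sval u) by rewrite cod_value.
have uc : cod (sval u) = dom c by rewrite -bc bE cod_mul.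
(* The unit [u] is absorbed into the last factor. What remains is [value p], which generates the
   same ideal as [b] and inherits its maximality. *)
have aE' : a = mul (value p) (mul (sval u) c) by rewrite aE bE mulA.
have pd : cod (value p) = dom (mul (sval u) c) by rewrite dom_mul.
have pb : ideal (value p) = ideal b by rewrite bE ideal_mul_unit//; exact: svalP.
have d_atom : atom (mul (sval u) c).
  apply: (cover_atom pd); rewrite -aE'.
    move=> apv; apply: nab.
    by apply: principal_right_ideal_trans apv _; rewrite pb;
      exact: principal_right_ideal_refl.
  move=> y ya nay; have -> : height (value p) = k by rewrite /height /above pb.
  by apply: kmax; apply/asboolP; exists y.
have [e /esym eE] := atom_rep_ex d_atom.
have [v ev [uv dE]] := ideal_eq_unit eE.
have pe : cod p = dom (edge_path e).
  by rewrite -cod_value pd dE dom_mul.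
exists (comp p (edge_path e) pe), (exist _ v uv); split; first by rewrite cod_comp.
rewrite dipath_value_comp// edge_path_value aE' dE /= mulA//.
by rewrite pd dE dom_mul.
Qed.

Lemma atom_mul_nonunit a x : atom a -> cod a = dom x -> ~ invertible (mul a x).
Proof.
move=> [nua _] ax [y [axy _ E _]]; apply: nua; apply: unit_ideal.
apply/principal_right_idealE; rewrite cod_mul// in axy.
by exists (mul x y); rewrite ?dom_mul// -mulA// E dom_mul.
Qed.

Local Notation path_value := (@path_value O S Q atom_rep).

(** Induction on both paths. An empty path against a nonempty one would make an atom divide a unit.
    Otherwise the two first atoms divide the same arrow, so they coincide and cancel. *)
Lemma path_value_uniq v w s t (g h : S) :
  is_path v s -> is_path w t -> path_end v s = dom g -> path_end w t = dom h ->
  invertible g -> invertible h -> mul (path_value v s) g = mul (path_value w t) h ->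
  [/\ v = w, s = t & g = h].
Proof.
move=> vs wt sg th ug uh E.
have vw : v = w.
  have := congr1 (@dom O S) E.
  by rewrite !dom_mul (dom_path_value _ vs)// (dom_path_value _ wt).
subst w; suff [-> ->] : s = t /\ g = h by [].
elim: s t v vs wt sg th E => [|e s IHs] [|f t] v /=.
- by move=> _ _ vg vh; rewrite !mul_idl.
- move=> _ [_ wt] vg th; rewrite mul_idl// => E.
  have [af _] := atom_repP f.
  have fc : cod (atom_rep f) = dom (path_value (cod (atom_rep f)) t).
    by rewrite dom_path_value.
  case: (@atom_mul_nonunit (atom_rep f) (mul (path_value (cod (atom_rep f)) t) h)) => //.
    by rewrite dom_mul.
  by rewrite -mulA// ?cod_path_value// -E.
- move=> [_ es] _ sg vh; rewrite mul_idl// => E.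
  have [ae _] := atom_repP e.
  have ec : cod (atom_rep e) = dom (path_value (cod (atom_rep e)) s).
    by rewrite dom_path_value.
  case: (@atom_mul_nonunit (atom_rep e) (mul (path_value (cod (atom_rep e)) s) g)) => //.
    by rewrite dom_mul.
  by rewrite -mulA// ?cod_path_value// E.
- move=> [_ es] [_ ft] sg th.
  have ec : cod (atom_rep e) = dom (path_value (cod (atom_rep e)) s).
    by rewrite dom_path_value.
  have fc : cod (atom_rep f) = dom (path_value (cod (atom_rep f)) t).
    by rewrite dom_path_value.
  rewrite !mulA ?cod_path_value// => E.
  have ef : e = f.
    have [ae _] := atom_repP e; have [af _] := atom_repP f.
    apply: atom_rep_inj; apply: atom_ideal_eq ae af _ _; apply/principal_right_idealE.
      by exists (mul (path_value (cod (atom_rep e)) s) g); rewrite ?dom_mul.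
    by exists (mul (path_value (cod (atom_rep f)) t) h); rewrite ?dom_mul.
  subst f; have [|-> ->//] := IHs t _ es ft sg th.
  by apply: mulI E; rewrite dom_mul.
Qed.

Lemma left_Rees_zappa_szep : exists (Q : digraph O) (G : groupoid O)
  (A : self_similar_action G (free_category Q)), isomorphic S (zappa_szep A).
Proof.
exists Q, G.
have uniq (p q : free_category Q) (u v : G) : cod p = dom u -> cod q = dom v ->
    mul (value p) (sval u) = mul (value q) (sval v) -> p = q /\ u = v.
  case: p q u v => [[x s] xs] [[y t] yt] [g ug] [h uh] /= sg th E.
  have [/= xy st gh] := path_value_uniq xs yt sg th ug uh E.
  by split; [apply: dipath_eq; rewrite /= xy st|apply: unit_arrow_eq].
have dl e : dom (atom_rep e) = @source O Q e by [].
have cl e : cod (atom_rep e) = @target O Q e by [].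
exists (@factorization_action _ _ Q atom_rep dl cl value_factorization_ex uniq).
exact: factorization_isomorphic.
Qed.

End LeftReesFactorization.

(** * Transfer of the left Rees conditions along maps preserving and reflecting divisibility *)

Section ReflectIdeals.
Variables (O O' : Type) (C : category O) (D : category O') (f : C -> D).
Hypothesis idealf : forall a b,
  principal_right_ideal a b <-> principal_right_ideal (f a) (f b).

Let ideal_sub a b : principal_right_ideal a `<=` principal_right_ideal b <->
  principal_right_ideal (f a) `<=` principal_right_ideal (f b).
Proof. by rewrite !principal_right_ideal_sub. Qed.

(** Rigidity and finiteness depend only on divisibility; cancellation is assumed separately. [f] is
    a bare function so that it may be the first projection of a Zappa-Szép product, which in general
    is not a functor. *)
Lemma left_Rees_reflect : left_cancellative C -> left_Rees D -> left_Rees C.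
Proof.
move=> lc [_ rrD finD]; split=> // [a b [c [ac bc]]|a].
  by rewrite !ideal_sub; apply: rrD; exists (f c); split; apply/idealf.
(* The ideal of [b] is the preimage of the ideal of [f b], so the ideals above [a] are among the
   preimages of those above [f a]. *)
apply: sub_finite_set (finite_image (fun J => f @^-1` J) (finD (f a))).
move=> _ [[b ->] [ab nba]] /=; exists (principal_right_ideal (f b)).
  split; first by exists (f b).
  by split; rewrite -ideal_sub.
by apply/seteqP; split=> c /idealf.
Qed.

End ReflectIdeals.

(** * Invariance of the left Rees property under isomorphism *)

Section IsomorphismIdeals.
Variables (O O' : Type) (C : category O) (D : category O') (F : functor C D).
Hypotheses (Fobj_inj : injective (fobj F)) (F_inj : injective F)
           (F_surj : forall d, exists c, F c = d).

Lemma functor_mul a b : cod a = dom b -> F (mul a b) = mul (F a) (F b).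
Proof.
move=> ab; have Fab : cod (F a) = dom (F b) by rewrite farr_cod farr_dom ab.
by rewrite -(compE ab) (farr_comp ab Fab) compE.
Qed.

Lemma left_Rees_isomorphism : left_Rees D -> left_Rees C.
Proof.
move=> D_Rees; apply: (left_Rees_reflect (f := F)) => //.
  move=> a b; rewrite !principal_right_idealE; split=> [[x ax ->]|[y ay E]].
    by exists (F x); rewrite ?functor_mul// farr_cod farr_dom ax.
  have [x xy] := F_surj y; subst y.
  (* Injectivity on objects reflects composability back to [C]. *)
  have ax : cod a = dom x by apply: Fobj_inj; rewrite -farr_cod ay farr_dom.
  by exists x => //; apply: F_inj; rewrite functor_mul.
move=> a x y ax ay; rewrite !compE => /(congr1 F); rewrite !functor_mul//.
have Fa z : cod a = dom z -> cod (F a) = dom (F z).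
  by rewrite farr_cod farr_dom => ->.
rewrite -(compE (Fa x ax)) -(compE (Fa y ay)).
by case: D_Rees => lcD _ _ /lcD /F_inj.
Qed.

End IsomorphismIdeals.

(** * Ideals and cancellation in a Zappa-Szép product with a groupoid *)

Section UnitAction.
Variables (O : Type) (G : groupoid O) (C : category O).
Variable A : self_similar_action G C.

Lemma groupoid_unit (g : G) : invertible g.
Proof.
have [h [gh [hg []]]] := has_inverse g; rewrite !compE => E E'.
by exists h.
Qed.

Lemma unit_mulI (D : category O) (g x y : D) : invertible g ->
  cod g = dom x -> cod g = dom y -> mul g x = mul g y -> x = y.
Proof.
move=> [h [gh hg _ hgE]] gx gy /(congr1 (mul h)).
by rewrite -!mulA// hgE !mul_idl.
Qed.

Lemma act_inverse (g h : G) (x : C) (gx : cod g = dom x)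
    (hgx : cod h = dom (act A g x gx)) : is_inverse h g -> act A h _ hgx = x.
Proof.
move=> [hg gh hgE _].
have hg_x : cod (comp h g hg) = dom x by rewrite cod_comp.
have ix : cod (idt (dom x) : G) = dom x by rewrite cod_idt.
rewrite -(ssa_SS2 hg_x hgx) -[RHS](ssa_SS1 A ix).
by apply: act_congr => //; rewrite compE hgE -gh gx.
Qed.

Lemma act_inj (g : G) (x y : C) (gx : cod g = dom x) (gy : cod g = dom y) :
  act A g x gx = act A g y gy -> x = y.
Proof.
have [h /is_inverse_sym hg] := groupoid_unit g; have [hgd _ _ _] := hg.
have hgx : cod h = dom (act A g x gx) by rewrite ssa_C1.
have hgy : cod h = dom (act A g y gy) by rewrite ssa_C1.
move=> E; rewrite -(act_inverse hgx hg) -(act_inverse hgy hg).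
exact: act_congr.
Qed.

Lemma act_surj (g : G) (z : C) : dom g = dom z ->
  exists (x : C) (gx : cod g = dom x), act A g x gx = z.
Proof.
have [h gh] := groupoid_unit g; have [ghd hgd _ _] := gh => gz.
have hz : cod h = dom z by rewrite hgd.
have ghz : cod g = dom (act A h z hz) by rewrite ssa_C1.
by exists (act A h z hz), ghz; apply: act_inverse.
Qed.

Local Notation Z := (zappa_szep A).

Lemma zappa_szep_ideal (p q : Z) : principal_right_ideal p q <->
  principal_right_ideal (sval p).1 (sval q).1.
Proof.
split=> [[r [pr ->]]|[z [pz qE]]].
  by exists (act A (sval p).2 (sval r).1 pr), (zs_comp_fst A pr).
have gz : dom (sval p).2 = dom z by rewrite -pz; symmetry; exact: (svalP p).
have [x [gx xz]] := act_surj gz.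
set g := (sval p).2 in gx xz.
(* The quotient [r] has first component [x], with [g . x = z]. Its second begins with the inverse
   [h] of [g|_x], to cancel the restriction produced by the product. *)
have [h [rh hr rhE hrE]] := groupoid_unit (rst A g x gx).
have hq : cod h = dom (sval q).2.
  by rewrite hr -ssa_C2 xz -(svalP q) qE cod_comp.
have xk : cod x = dom (comp h (sval q).2 hq) by rewrite dom_comp -rh -ssa_C3.
pose r : Z := exist _ (x, comp h (sval q).2 hq) xk.
exists r, gx; apply: zs_eq => /=.
  by rewrite qE; apply: comp_congr.
rewrite !compE -mulA// rhE mul_idl//.
by rewrite -ssa_C2 xz -(svalP q) qE cod_comp.
Qed.

Lemma zappa_szep_left_cancellative : left_cancellative C -> left_cancellative Z.
Proof.
move=> lcC p q r pq pr E.
have E1 := congr1 (fun p : Z => (sval p).1) E.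
have E2 := congr1 (fun p : Z => (sval p).2) E.
have qr1 : (sval q).1 = (sval r).1 by apply: act_inj (lcC _ _ _ _ _ E1).
apply: zs_eq => //; move: E2; rewrite /= !compE.
have -> : rst A (sval p).2 (sval q).1 pq = rst A (sval p).2 (sval r).1 pr.
  exact: rst_congr.
apply: unit_mulI; first exact: groupoid_unit.
  by rewrite -ssa_C3 -qr1; apply: (svalP q).
by rewrite -ssa_C3; apply: (svalP r).
Qed.

Lemma zappa_szep_left_Rees : left_Rees C -> left_Rees Z.
Proof.
move=> C_Rees; apply: (left_Rees_reflect zappa_szep_ideal _ C_Rees).
by case: C_Rees => lcC _ _; apply: zappa_szep_left_cancellative.
Qed.

End UnitAction.

(** * The free category is left Rees *)

Section FreeCategory.
Variables (V : Type) (Q : digraph V).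

Lemma is_path_suffix v s t :
  is_path v (s ++ t) -> @is_path V Q (path_end v s) t.
Proof. by elim: s v => [|e s IHs] v //= [_ /IHs]. Qed.

Lemma catI (T : Type) (s t u : seq T) : s ++ t = s ++ u -> t = u.
Proof. by elim: s => //= x s IHs [/IHs]. Qed.

Lemma cat_comparable (T : Type) (s t u v : seq T) : s ++ u = t ++ v ->
  (exists w, t = s ++ w) \/ (exists w, s = t ++ w).
Proof.
elim: s t => [|x s IHs] [|y t] /=; first by left; exists [::].
- by left; exists (y :: t).
- by right; exists (x :: s).
- by case=> -> /IHs[[w ->]|[w ->]]; [left|right]; exists w.
Qed.

Lemma free_category_ideal (p q : free_category Q) : principal_right_ideal p q <->
  (sval q).1 = (sval p).1 /\ exists t, (sval q).2 = (sval p).2 ++ t.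
Proof.
split=> [[r [pr ->]]|[vE [t tE]]]; first by split=> //; exists (sval r).2.
(* The remainder [t] is a path from the end of [p] because it is a suffix of the path [q]. *)
have pt : is_path (path_end (sval p).1 (sval p).2) t.
  by apply: is_path_suffix; rewrite -tE -vE; apply: (svalP q).
pose r : free_category Q := exist (fun p => is_path p.1 p.2) (_, t) pt.
exists r, erefl; apply: dipath_eq => /=.
by rewrite -tE -vE -surjective_pairing.
Qed.

Lemma free_category_left_Rees : left_Rees (free_category Q).
Proof.
split=> [p q r pq pr|p q [r []]|p].
- move=> /(congr1 (fun p : free_category Q => (sval p).2))/catI E.
  apply: dipath_eq; rewrite [sval q]surjective_pairing [sval r]surjective_pairing E.
  by congr pair; rewrite -[LHS]pq -[RHS]pr.
- move=> /free_category_ideal[vp [t tE]] /free_category_ideal[vq [u uE]].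
  rewrite !principal_right_ideal_sub !free_category_ideal -vp -vq.
  have /cat_comparable[] : (sval p).2 ++ t = (sval q).2 ++ u by rewrite -tE.
    by right.
  by left.
(* An ideal containing that of [p] is determined by the length of a prefix of [p]; the successor in
   the bound admits the full length. *)
pose prefix_ideal n : set (free_category Q) := [set q |
  (sval q).1 = (sval p).1 /\ exists t, (sval q).2 = take n (sval p).2 ++ t].
apply: sub_finite_set (finite_image prefix_ideal (finite_II (size (sval p).2).+1)).
move=> _ [[q ->] [/principal_right_ideal_sub/free_category_ideal[vp [t tE]] _]] /=.
exists (size (sval q).2); first by rewrite /= ltnS tE size_cat leq_addr.
apply/seteqP; rewrite /prefix_ideal tE take_size_cat// vp.
by split=> r; rewrite free_category_ideal.
Qed.

End FreeCategory.

Theorem theorem4p3 (O : Type) (S : category O) :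
  left_Rees S <->
  exists (V : Type) (Q : digraph V) (G : groupoid V)
         (A : self_similar_action G (free_category Q)),
    isomorphic S (zappa_szep A).
Proof.
split=> [/left_Rees_zappa_szep|]; first by exists O.
move=> [V [Q [G [A [F [[fobj' fobjK _] [F' FK F'K]]]]]]].
apply: (@left_Rees_isomorphism _ _ _ _ F).
- exact: can_inj fobjK.
- exact: can_inj FK.
- by move=> d; exists (F' d).
- exact: zappa_szep_left_Rees (free_category_left_Rees Q).
Qed.
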